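(* Let $G=(V,E)$ be an $n$-node graph and let $\Pi$ be a problem in O-LOCAL. Let $(\gamma,\delta)$ be a colored BFS-clustering of $G$, and assume that every node $v\in V$ initially knows its color $\gamma(v)$ and its distance $\delta(v)$. Let $c=\max_{v\in V}\gamma(v)$. Then $\Pi$ can be solved on $G$ by a (deterministic) distributed algorithm in the Sleeping model with awake complexity $O(\log c)$ and round complexity $O(c\cdot n)$.
   Context: **Sleeping model.** The network is a simple connected $n$-node graph $G=(V,E)$; each node is a processor with an identifier (ID), a positive integer that is unique in the network and taken from a range polynomial in $n$. Every node initially knows $n$. Computation proceeds in synchronous rounds $1,2,3,\dots$. In each round each node is awake or asleep; all nodes are awake at round 1. A node awake at a round can send a message of arbitrary size to each of its neighbors, receives the messages sent to it in that round by its awake neighbors, and performs unbounded local computation. At the end of a round $r$ in which it is awake, a node may either stay awake for round $r+1$, or choose (as a function of its internal state) an integer $t\ge 1$ and sleep for $t$ rounds, waking up at round $r+t+1$. A sleeping node neither sends nor receives, and messages sent to a sleeping node are lost. The *round complexity* of an algorithm is the maximum over all nodes $v$ (and all admissible instances) of the number of rounds until $v$ terminates; the *awake complexity* is the maximum over all nodes $v$ (and all admissible instances) of the number of rounds during which $v$ is awake. **Class O-LOCAL.** Consider graph problems whose solutions are labelings of the nodes (one output per node; nodes may also have inputs). For an acyclic orientation $\mu$ of the edges of $G$, let $G_\mu$ be the resulting directed graph, and for $v\in V$ let $G_\mu(v)$ be the subgraph of $G_\mu$ induced by $v$ and all nodes reachable from $v$ by directed paths. A problem $\Pi$ is in O-LOCAL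 if there is a sequential greedy algorithm of the following form that produces a correct solution of $\Pi$ for every input graph $G$ and every acyclic orientation $\mu$ of its edges: nodes are picked one by one in an arbitrary order subject to the constraint that $v$ is picked only after all nodes of $G_\mu(v)\setminus\{v\}$ have been given an output, and when $v$ is picked its output is computed only from $G_\mu(v)$ (with the IDs and inputs of its nodes) and the outputs already computed at the nodes of $G_\mu(v)\setminus\{v\}$. **Colored BFS-clustering.** A colored BFS-clustering of $G=(V,E)$ is a pair of functions $(\gamma,\delta)$ assigning to each $v\in V$ a positive integer $\gamma(v)$ (its color) and a non-negative integer $\delta(v)$ such that, for every $i$ and every connected component $C$ of the subgraph of $G$ induced by $\{v\in V\mid \gamma(v)=i\}$, there is a unique node $u$ of $C$ with $\delta(u)=0$, and for every $v\in C$, $\delta(v)$ is the distance between $u$ and $v$ in $C$. **Convention.** The constants hidden in the $O(\cdot)$ notation do not depend on $n$, $c$, $G$ or the clustering, and $O(\log c)$ is understood as $O(1+\log c)$ (so that it is $O(1)$ when $c=1$). *)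

(* Defs.v *)
From mathcomp Require Import all_boot.

Set Implicit Arguments.
Unset Strict Implicit.
Unset Printing Implicit Defensive.

Record sgraph := SGraph {
  vertex :> finType;
  adj : rel vertex;
  adj_sym : symmetric adj;
  adj_irr : irreflexive adj;
  graph_connected : forall u v : vertex, connect adj u v;
  graph_nonempty : 0 < #|vertex|
}.

Definition nnodes (G : sgraph) : nat := #|vertex G|.

Definition induced (G : sgraph) (A : {set G}) : rel G :=
  [rel u v | [&& adj u v, u \in A & v \in A]].

Definition component (G : sgraph) (A C : {set G}) : Prop :=
  exists2 v, v \in A & C = [set w | connect (induced A) v w].

Definition is_dist (T : eqType) (e : rel T) (u v : T) (d : nat) : Prop :=
  (exists p, [/\ path e u p, last u p = v & size p = d]) /\
  (forall p, path e u p -> last u p = v -> d <= size p).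

Definition polynomially_bounded (f : nat -> nat) : Prop :=
  exists a k, forall n, 0 < n -> f n <= a * n ^ k.

Definition valid_ids (idmax : nat -> nat) (G : sgraph) (id : G -> nat) : Prop :=
  injective id /\ forall v, 0 < id v <= idmax (nnodes G).

(* [port v] lists the neighbors of [v] in the (arbitrary) order in which [v]
   numbers its incident edges. *)
Definition valid_ports (G : sgraph) (port : G -> seq G) : Prop :=
  forall v, uniq (port v) /\ forall u, (u \in port v) = adj v u.

Definition problem (I O : Type) : Type :=
  forall G : sgraph, (G -> I) -> (G -> O) -> Prop.

Definition acyclic_orientation (G : sgraph) (mu : rel G) : Prop :=
  [/\ forall u v, mu u v -> adj u v,
      forall u v, adj u v -> mu u v (+) mu v u
    & forall p : seq G, cycle mu p -> p = [::]].

(* The directed graph G_mu(v) with its inputs and the outputs computed so far.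
   Its nodes are named by their identifiers, so that a function of a view can
   use nothing but the isomorphism type of this labeled digraph: the nodes are
   the [i] such that [view_input i <> None]. *)
Record view (I O : Type) := View {
  view_root : nat;
  view_edge : rel nat;
  view_input : nat -> option I;
  view_output : nat -> option O
}.

Section Greedy.
Variables (I O : Type) (G : sgraph) (id : G -> nat) (inp : G -> I).
Variable mu : rel G.

Definition view_node (v : G) (i : nat) : option G :=
  [pick u | connect mu v u && (id u == i)].

Definition view_of (out : G -> option O) (v : G) : view I O :=
  {| view_root := id v;
     view_edge := fun i j =>
       if (view_node v i, view_node v j) is (Some u, Some w)
       then mu u w else false;
     view_input := fun i => omap inp (view_node v i);
     view_output := fun i => obind out (view_node v i) |}.

(* Every node is picked exactly once, after all other nodes reachable from it. *)
Definition admissible_order (s : seq G) : Prop :=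
  [/\ uniq s, forall v, v \in s
    & forall u v, connect mu v u -> u != v -> index u s < index v s].

Definition greedy_pick (F : view I O -> O) (out : G -> option O) (v : G) :
    G -> option O :=
  fun u => if u == v then Some (F (view_of out v)) else out u.

Definition greedy_run (F : view I O -> O) (s : seq G) : G -> option O :=
  foldl (greedy_pick F) (fun=> None) s.

End Greedy.

Definition O_LOCAL (idmax : nat -> nat) (I O : Type) (Pi : problem I O) : Prop :=
  exists F : view I O -> O,
    forall (G : sgraph) (id : G -> nat) (inp : G -> I) (mu : rel G) (s : seq G),
      valid_ids idmax id -> acyclic_orientation mu -> admissible_order mu s ->
      exists2 out : G -> O,
        (forall v, greedy_run id inp mu F s v = Some (out v)) & Pi G inp out.

(* [Sleep 0] means staying awake for the next round. *)
Inductive action (O : Type) := Sleep of nat | Terminate of O.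

(* [X] is the type of the local inputs. The arguments of [init] are the number
   of nodes of the network, the identifier and the local input of the node;
   [send s p] is the message sent on port [p]; the second argument of [receive]
   lists the messages received, by port. *)
Record algorithm (X O : Type) := Algorithm {
  state : Type;
  message : Type;
  init : nat -> nat -> X -> state;
  send : state -> nat -> option message;
  receive : state -> seq (option message) -> state;
  act : state -> action O
}.

(* [Running s w]: internal state [s], next awake at round [w]. *)
Inductive status (S O : Type) := Running of S & nat | Terminated of O.

Section Execution.
Variables (X O : Type) (A : algorithm X O).
Variables (G : sgraph) (id : G -> nat) (port : G -> seq G) (x : G -> X).

Definition config : Type := G -> status (state A) O.

Definition awake_in (cf : config) (r : nat) (v : G) : bool :=
  if cf v is Running _ w then w == r else false.

Definition delivered (cf : config) (r : nat) (u v : G) : option (message A) :=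
  if cf u is Running s w
  then if w == r then send s (index v (port u)) else None
  else None.

Definition round (r : nat) (cf : config) : config := fun v =>
  match cf v with
  | Running s w =>
      if w == r then
        let s' := receive s [seq delivered cf r u v | u <- port v] in
        match act s' with
        | Sleep t => Running _ s' (r + t + 1)
        | Terminate o => Terminated _ o
        end
      else Running _ s w
  | Terminated o => Terminated _ o
  end.

(* The configuration after the first [r] rounds; rounds are numbered from 1. *)
Fixpoint exec (r : nat) : config :=
  if r is r'.+1 then round r (exec r')
  else fun v => Running _ (init A (nnodes G) (id v) (x v)) 1.

Definition awake_at (r : nat) (v : G) : bool := awake_in (exec r.-1) r v.

Definition outputs (out : G -> O) : Prop :=
  forall v, exists r, exec r v = Terminated _ (out v).

Definition awake_complexity_le (b : nat) : Prop :=
  forall v T, \sum_(1 <= r < T.+1) awake_at r v <= b.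

Definition round_complexity_le (b : nat) : Prop :=
  forall v, exists2 r, r <= b & exists o, exec r v = Terminated _ o.

End Execution.

Definition color_class (G : sgraph) (gamma : G -> nat) (i : nat) : {set G} :=
  [set v | gamma v == i].

Definition colored_BFS_clustering (G : sgraph) (gamma delta : G -> nat) : Prop :=
  (forall v, 0 < gamma v) /\
  forall (i : nat) (C : {set G}), component (color_class gamma i) C ->
    exists u, [/\ u \in C, delta u = 0,
                  forall w, w \in C -> delta w = 0 -> w = u
                & forall v, v \in C -> is_dist (induced C) u v (delta v)].

(* Main.v *)
(* Orient every edge towards the smaller color, and towards the smaller
   identifier inside a color class. All awake nodes exchange everything they
   know, and it is enough that each node v learns the inputs and the out-edges of
   G_mu(v): it then reruns the greedy algorithm locally.
   Time is cut into phases of 2n rounds, one for each positive integer. In phase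
   g every cluster of color g gathers its knowledge at the root and broadcasts it
   back along the distances delta, each node being awake in at most 4 rounds.
   Between colors i < j, information is passed in the first round of a phase m
   with i < m <= j: if k is such that floor(j / 2^k) = floor(i / 2^k) + 1, then m,
   the corresponding multiple of 2^k, is the next multiple of 2^k after i and the
   last one up to j. As k <= log2 j, node v only needs to try the values of k up
   to the logarithm of the largest color in its neighborhood, which it learns in
   round 1. *)

Require Import Defs.
From mathcomp Require Import all_boot zify.
From Stdlib Require Import FunctionalExtensionality.

Set Implicit Arguments.
Unset Strict Implicit.
Unset Printing Implicit Defensive.

(** * Dyadic arithmetic, sorted schedules and graph distances *)

Lemma dyadic_separation i j :
  i < j -> exists2 k, k <= trunc_log 2 j & j %/ 2 ^ k = (i %/ 2 ^ k).+1.
Proof.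
move=> ltij.
suff [k jk] : exists k, j %/ 2 ^ k = (i %/ 2 ^ k).+1.
  exists k => //; apply: trunc_log_max => //.
  by rewrite -divn_gt0 ?expn_gt0 // jk.
(* Both numbers are halved until their halves agree; then [j = i + 1] and [k = 0] works. *)
elim/ltn_ind: j i ltij => j IHj i ltij.
have [eq2 | ne2] := eqVneq (i %/ 2) (j %/ 2).
  by exists 0; rewrite !divn1; lia.
have [||k jk] := IHj (j %/ 2) _ (i %/ 2); [lia | lia |].
by exists k.+1; rewrite expnS !divnMA.
Qed.

(** Advances a schedule by one round, for the induction in [node_statusP]. *)
Lemma filter_ltn_sorted (s : seq nat) r : sorted ltn s ->
  [seq t <- s | r < t] =
  (if r.+1 \in s then [:: r.+1] else [::]) ++ [seq t <- s | r.+1 < t].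
Proof.
elim: s => //= t s IHs lt_s; have {}IHs := IHs (path_sorted lt_s).
rewrite inE; have [eq_t|ne_t] := eqVneq r.+1 t.
  rewrite -eq_t in lt_s *; rewrite ltnSn ltnn /=; congr cons.
  apply: eq_in_filter => u u_s; have := order_path_min ltn_trans lt_s.
  by move=> /allP/(_ u u_s) /= ltu; rewrite ltu (ltnW ltu).
rewrite IHs /=; have -> : (r.+1 < t) = (r < t) by lia.
case: ltnP => // lt_rt; case: ifP => // r_s.
by have := order_path_min ltn_trans lt_s; move=> /allP/(_ _ r_s) /=; lia.
Qed.

Lemma sum_mem_le (s : seq nat) m n : \sum_(m <= r < n) (r \in s) <= size s.
Proof.
rewrite -big_mkcond sum1_count -size_filter.
apply: uniq_leq_size; first exact/filter_uniq/iota_uniq.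
by move=> r; rewrite mem_filter => /andP[].
Qed.

Lemma is_dist_lt_card (T : finType) (e : rel T) u v d :
  is_dist e u v d -> d < #|T|.
Proof.
move=> [[p [e_p last_p _]] min_d].
case/shortenP: e_p last_p => q e_q uniq_q _ last_q.
apply: leq_ltn_trans (min_d q e_q last_q) _.
by rewrite -[_ < _]/(size (u :: q) <= _) -(card_uniqP uniq_q) max_card.
Qed.

(** [y] precedes [v] on a shortest path; a shorter path to [y] would extend to [v]. Inside a
    cluster, [y] serves as the parent of [v]. *)
Lemma is_dist_pred (T : eqType) (e : rel T) u v d :
  is_dist e u v d.+1 -> exists y, e y v /\
    forall d', is_dist e u y d' -> d' = d.
Proof.
move=> [[p [e_p last_p size_p]] min_d].
case/lastP: p e_p last_p size_p => // p x.
rewrite rcons_path last_rcons size_rcons => /andP[e_p e_x] eq_x [size_p].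
rewrite {x}eq_x in e_x.
exists (last u p); split=> // d' [[q [e_q last_q size_q]] min_d'].
have := min_d' p e_p erefl.
have := min_d (rcons q v); rewrite rcons_path last_rcons size_rcons e_q last_q.
by move=> /(_ e_x erefl); lia.
Qed.

(** * The orientation by decreasing keys and its greedy run *)

Section KeyOrientation.
Variables (I O : Type) (F : view I O -> O).
Variables (G : sgraph) (id key : G -> nat) (inp : G -> I).
Hypothesis key_inj : injective key.

Definition key_orientation : rel G := [rel v u | adj v u && (key u < key v)].
Local Notation mu := key_orientation.

Lemma connect_key v u : connect mu v u -> u = v \/ key u < key v.
Proof.
case/connectP=> p; elim: p v => [|x p IHp] v /=; first by left.
case/andP=> /andP[_ lt_x] mu_p eq_u.
by right; case: (IHp x mu_p eq_u) => [->|] //; lia.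
Qed.

Lemma key_orientation_acyclic : acyclic_orientation mu.
Proof.
split=> [u v /andP[] //|u v adj_uv|].
  rewrite /key_orientation /= (adj_sym v u) adj_uv /=.
  have : key u != key v.
    by apply: contraTneq adj_uv => /key_inj ->; rewrite adj_irr.
  by case: ltngtP.
case=> // v p /=; rewrite rcons_path => /andP[mu_p /andP[_ lt_v]].
have [] : last v p = v \/ key (last v p) < key v.
- by apply: connect_key; apply/connectP; exists p.
- by move=> eq_v; rewrite eq_v ltnn in lt_v.
- by lia.
Qed.

Definition key_order : seq G := sort (fun u v => key u <= key v) (enum G).

Lemma key_order_admissible : admissible_order mu key_order.
Proof.
split=> [||u v mu_vu ne_uv]; first by rewrite sort_uniq enum_uniq.
  by move=> v; rewrite mem_sort mem_enum.
have lt_uv : key u < key v.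
  by case: (connect_key mu_vu) => // eq_uv; rewrite eq_uv eqxx in ne_uv.
have tr : transitive (fun u v : G => key u <= key v).
  by move=> y x z; apply: leq_trans.
have srt : sorted (fun u v : G => key u <= key v) key_order.
  by apply: sort_sorted => x y; apply: leq_total.
rewrite ltnNge; apply/negP=> le_vu.
have := sorted_leq_index tr (fun x => leqnn _) srt.
move=> /(_ v u); rewrite !mem_sort !mem_enum => /(_ isT isT le_vu); lia.
Qed.

Lemma view_of_ext (out out' : G -> option O) v :
  (forall u, connect mu v u -> out u = out' u) ->
  view_of id inp mu out v = view_of id inp mu out' v.
Proof.
move=> eq_out; rewrite /view_of; congr View.
apply: functional_extensionality => i; rewrite /view_node.
by case: pickP => //= u /andP[/eq_out].
Qed.

Lemma greedy_run_cat s1 s2 v : v \notin s2 ->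
  greedy_run id inp mu F (s1 ++ s2) v = greedy_run id inp mu F s1 v.
Proof.
rewrite /greedy_run foldl_cat; elim: s2 (foldl _ _ s1) => //= x s2 IHs out.
by rewrite inE negb_or => /andP[/negPf ne_vx] /IHs ->; rewrite /greedy_pick ne_vx.
Qed.

(** Turns the sequential run into a recursive equation. When [v] is picked, the other nodes that it
    reaches have their final outputs and [v] has none, hence the mask; later picks do not touch
    [v]. *)
Lemma greedy_run_fix s v (out := greedy_run id inp mu F s) :
  admissible_order mu s ->
  out v = Some (F (view_of id inp mu (fun u => if u == v then None else out u) v)).
Proof.
rewrite /out => -[uniq_s mem_s lt_s] {out}; have v_s := mem_s v.
case/splitPr: v_s uniq_s mem_s lt_s => s1 s2 uniq_s mem_s lt_s.
move: (uniq_s); rewrite cat_uniq /= negb_or => /and3P[_ /andP[v_s1 s12] /andP[v_s2 _]].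
rewrite -cat_rcons greedy_run_cat // /greedy_run -cats1 foldl_cat /=.
rewrite {1}/greedy_pick eqxx; congr (Some (F _)); apply: view_of_ext => u mu_vu.
rewrite -/(greedy_run _ _ _ _ _).
case: eqVneq => [->|ne_uv]; first by rewrite -[s1]cat0s greedy_run_cat.
have := lt_s u v mu_vu ne_uv.
rewrite !index_cat (negPf v_s1) /= eqxx addn0; case: ifP => [u_s1 _|_]; last by lia.
rewrite -/(greedy_run _ _ _ _ _) -catA greedy_run_cat //=.
rewrite inE negb_or ne_uv /=.
by apply: contra s12 => u_s2; apply/hasP; exists u.
Qed.

End KeyOrientation.

(* A partial description of an oriented graph: it maps the identifier of each
   node it describes to the input and to the identifiers of the out-neighbors
   of that node. *)
Definition knowledge (I : Type) : Type := nat -> option (I * seq nat).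

(** * Local simulation of the greedy run from partial knowledge *)

Section LocalSimulation.
Variables (I O : Type) (F : view I O -> O).

(* Keys decrease along edges, so [k > key i] is enough fuel in [reach K k i] and
   [simulate K k i]. *)
Fixpoint reach (K : knowledge I) k i a : bool :=
  (i == a) ||
  (if k is k'.+1 then
     if K i is Some (_, outs) then has (fun j => reach K k' j a) outs else false
   else false).

Definition known_edge (K : knowledge I) a b : bool :=
  if K a is Some (_, outs) then b \in outs else false.

Fixpoint simulate (K : knowledge I) k i : O :=
  F {| view_root := i;
       view_edge := fun a b =>
         [&& reach K k i a, reach K k i b & known_edge K a b];
       view_input := fun a => if reach K k i a then omap fst (K a) else None;
       view_output := fun a =>
         if k is k'.+1 then
           if (a != i) && reach K k i a then Some (simulate K k' a) else None
         else None |}.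

Variables (G : sgraph) (id key : G -> nat) (port : G -> seq G) (inp : G -> I).
Hypothesis id_inj : injective id.
Hypothesis portP : valid_ports port.
Local Notation mu := (key_orientation key).

Definition description v : I * seq nat :=
  (inp v, [seq id u | u <- port v & key u < key v]).

Lemma mem_description v u : (id u \in (description v).2) = mu v u.
Proof.
rewrite mem_map // mem_filter andbC; congr (_ && _).
exact: (portP v).2.
Qed.

Variable K : knowledge I.

Definition informed v : Prop :=
  forall u, connect mu v u -> K (id u) = Some (description u).

Lemma informed_connect v u : informed v -> connect mu v u -> informed u.
Proof. by move=> Kv mu_vu w mu_uw; apply/Kv/(connect_trans mu_vu). Qed.

Lemma reachP k v a : informed v -> key v < k ->
  reach K k (id v) a = isSome (view_node id mu v a).
Proof.
elim: k v => // k IHk v Kv lt_v /=; rewrite Kv ?connect0 // /view_node.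
case: pickP => /= [u /andP[mu_vu /eqP eq_a]|no_u].
  case/connectP: mu_vu => -[|x p] /= mu_p eq_u; first by rewrite -eq_a eq_u eqxx.
  case/andP: mu_p => mu_x mu_p; apply/orP; right; apply/hasP; exists (id x).
    by rewrite mem_description.
  have mu_vx := connect1 mu_x; case/andP: mu_x => _ lt_x.
  rewrite IHk; [|exact: informed_connect mu_vx|lia].
  rewrite /view_node; case: pickP => //= /(_ (last x p)).
  by rewrite -eq_a eq_u eqxx andbT => /connectP[]; exists p.
apply/negbTE; rewrite negb_or; apply/andP; split.
  by have := no_u v; rewrite connect0 /= => ->.
apply/hasPn => j /mapP[x]; rewrite mem_filter => /andP[lt_x x_v] ->.
have mu_x : mu v x by rewrite /key_orientation /= lt_x -(portP v).2 x_v.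
rewrite IHk; [|exact: informed_connect (connect1 mu_x)|lia].
rewrite /view_node; case: pickP => // u /andP[mu_xu eq_u].
by have := no_u u; rewrite eq_u (connect_trans (connect1 mu_x) mu_xu).
Qed.

(** [simulate] unfolds to the equation of [greedy_run_fix]. The two views agree field by field, and
    the nodes reached from [v] have smaller keys, so one unit less of fuel suffices for them. *)
Lemma simulateP s k v out : admissible_order mu s ->
  (forall v, greedy_run id inp mu F s v = Some (out v)) ->
  informed v -> key v < k -> simulate K k (id v) = out v.
Proof.
move=> adm_s out_s; elim: k v => // k IHk v Kv lt_v.
apply: Some_inj; rewrite -out_s (greedy_run_fix F id inp v adm_s).
have nodeP a u : view_node id mu v a = Some u -> connect mu v u /\ a = id u.
  by rewrite /view_node; case: pickP => // w /andP[mu_vw /eqP <-] [<-].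
rewrite /view_of; cbn [simulate].
congr (Some (F (View _ _ _ _))); apply: functional_extensionality => a.
- apply: functional_extensionality => b; rewrite !reachP //.
  case Ea: view_node => [u|] //; case Eb: view_node => [w|] //=.
  have [mu_u ->] := nodeP _ _ Ea; have [_ ->] := nodeP _ _ Eb.
  by rewrite /known_edge Kv // -mem_description.
- rewrite reachP //; case Ea: view_node => [u|] //=.
  by have [mu_u ->] := nodeP _ _ Ea; rewrite Kv.
- rewrite reachP // andbC; case Ea: view_node => [u|] //=.
  have [mu_u ->] := nodeP _ _ Ea; rewrite (inj_eq id_inj).
  case: eqVneq => //= ne_u; rewrite out_s; congr Some; apply: IHk.
    exact: informed_connect mu_u.
  by case: (connect_key mu_u) ne_u => [->|]; [rewrite eqxx | lia].
Qed.

End LocalSimulation.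

Arguments simulate : simpl never.

(** * The protocol and its wake-up rounds *)

Section Protocol.
Variables (idmax : nat -> nat) (I O : Type) (F : view I O -> O).

(** Encodes the lexicographic order of color and identifier, since valid identifiers are at most
    [idmax n]. *)
Definition node_key (n color i : nat) : nat := color * (idmax n).+1 + i.

Definition merge (K1 K2 : knowledge I) : knowledge I :=
  fun i => if K1 i is Some f then Some f else K2 i.

(** Strictly above [g] even when [2 ^ k] divides [g]: a meeting must come after the phase of the
    smaller color. *)
Definition ceil2 k g := (g %/ 2 ^ k).+1 * 2 ^ k.
Definition floor2 k g := g %/ 2 ^ k * 2 ^ k.

(* Color class [m] works in the [2n] rounds that start at round [2 n m]. *)
Definition phase n m : nat := 2 * n * m.

(* In the phase of its own color, a node at depth [d] of its cluster is awake to
   hear from its children and then to report to its parent (rounds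
   [phase n g + n - d - 1] and [phase n g + n - d]), and to hear from its parent
   and then to inform its children (rounds [phase n g + n + d] and
   [phase n g + n + d + 1]). The value [floor2 k g] may be [0], which the filter
   removes. *)
Definition wakeups n g d cmax : seq nat :=
  let ks := iota 0 (trunc_log 2 cmax).+1 in
  sort leq (undup [seq t <- [:: phase n g + n - d - 1; phase n g + n - d;
                                phase n g + n + d; phase n g + n + d + 1]
                           ++ [seq phase n (ceil2 k g) | k <- ks]
                           ++ [seq phase n (floor2 k g) | k <- ks] | 1 < t]).

(* [Active i key K cur todo]: the last awake round was [cur], the next ones are
   those of [todo]. *)
Inductive node_state :=
  | Fresh of nat & nat & I * nat * nat
  | Active of nat & nat & knowledge I & nat & seq nat.

Inductive node_message := Hello of nat & nat | Know of knowledge I.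

Definition hello (m : option node_message) : option (nat * nat) :=
  if m is Some (Hello g i) then Some (g, i) else None.

Definition know (m : option node_message) : option (knowledge I) :=
  if m is Some (Know K) then Some K else None.

Definition start n i (x : I * nat * nat) (nb : seq (nat * nat)) : node_state :=
  let: (inp, g, d) := x in
  let key := node_key n g i in
  let outs := [seq q.2 | q <- nb & node_key n q.1 q.2 < key] in
  Active i key (fun j => if j == i then Some (inp, outs) else None) 1
    (wakeups n g d (\max_(q <- (g, i) :: nb) q.1)).

Definition receive_messages (s : node_state) (ms : seq (option node_message)) :=
  match s with
  | Fresh n i x => start n i x (pmap hello ms)
  | Active i key K cur todo =>
      Active i key (foldr merge K (pmap know ms)) (head cur todo) (behead todo)
  end.

(** [Sleep s] chosen in round [cur] leads to round [cur + s + 1], hence the subtraction. The fuel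
    [key.+1] is what [simulateP] asks for. *)
Definition next_action (s : node_state) : action O :=
  match s with
  | Fresh _ _ _ => Sleep O 0
  | Active i key K cur todo =>
      if todo is t :: _ then Sleep O (t - cur - 1)
      else Terminate (simulate F K key.+1 i)
  end.

Definition send_message (s : node_state) (p : nat) : option node_message :=
  match s with
  | Fresh _ i (_, g, _) => Some (Hello g i)
  | Active _ _ K _ _ => Some (Know K)
  end.

Definition protocol : algorithm (I * nat * nat) O :=
  Algorithm Fresh send_message receive_messages next_action.

Lemma ceil2_le k g m : k <= trunc_log 2 m -> g <= m -> 0 < m -> ceil2 k g <= 2 * m.
Proof.
move=> le_k le_g m_gt0; rewrite /ceil2 mulSn mul2n -addnn leq_add //.
  by apply: leq_trans (trunc_logP (isT : 1 < 2) m_gt0); rewrite leq_exp2l.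
by apply: leq_trans (leq_divM _ _) le_g.
Qed.

Lemma wakeups_sorted n g d cmax : sorted ltn (wakeups n g d cmax).
Proof.
rewrite ltn_sorted_uniq_leq sort_uniq undup_uniq sort_sorted //.
exact: leq_total.
Qed.

Lemma mem_wakeups n g d cmax t :
  t \in wakeups n g d cmax =
  (1 < t) && ((t \in [:: phase n g + n - d - 1; phase n g + n - d;
                         phase n g + n + d; phase n g + n + d + 1])
   || (t \in [seq phase n (ceil2 k g) | k <- iota 0 (trunc_log 2 cmax).+1])
   || (t \in [seq phase n (floor2 k g) | k <- iota 0 (trunc_log 2 cmax).+1])).
Proof. by rewrite mem_sort mem_undup mem_filter !mem_cat orbA. Qed.

Lemma size_wakeups n g d cmax :
  size (wakeups n g d cmax) <= 4 + 2 * (1 + trunc_log 2 cmax).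
Proof.
rewrite size_sort; apply: leq_trans (size_undup _) _.
rewrite size_filter; apply: leq_trans (count_size _ _) _.
by rewrite !size_cat !size_map size_iota /=; lia.
Qed.

(** Meetings start by round [2 * n * (2 * m)], and the phase of color [g] is over by
    [2 * n * m + 2 * n]. *)
Lemma wakeups_le n g d cmax m t : 0 < m -> d < n -> g <= m -> cmax <= m ->
  t \in wakeups n g d cmax -> t <= 4 * (m * n).
Proof.
move=> m_gt0 lt_d le_g le_cm; rewrite mem_wakeups /phase => /andP[_].
have le_mn : g * n <= m * n by rewrite leq_mul2r le_g orbT.
have le_nm : n <= m * n by rewrite leq_pmull.
have eqg : 2 * n * g = 2 * (g * n) by lia.
have kP k : k \in iota 0 (trunc_log 2 cmax).+1 -> k <= trunc_log 2 m.
  rewrite mem_iota ltnS => /leq_trans; apply; exact: leq_trunc_log.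
case/orP=> [/orP[]|]; first by rewrite eqg !inE => /or4P[] /eqP ->; lia.
  case/mapP=> k /kP le_k ->; have le_ce := ceil2_le le_k le_g m_gt0.
  have : n * ceil2 k g <= n * (2 * m) by rewrite leq_mul2l le_ce orbT.
  lia.
case/mapP=> k _ ->.
have le_fl : floor2 k g <= m by apply: leq_trans (leq_divM _ _) le_g.
by have : n * floor2 k g <= n * m; [rewrite leq_mul2l le_fl orbT | lia].
Qed.

(** * Keys, colors and schedules on a fixed network *)

Section Run.
Variables (G : sgraph) (id : G -> nat) (port : G -> seq G).
Variables (inp : G -> I) (gamma delta : G -> nat).
Hypothesis idP : valid_ids idmax id.
Hypothesis portP : valid_ports port.
Hypothesis clustering : colored_BFS_clustering gamma delta.

Let x v := (inp v, gamma v, delta v).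
Let n := nnodes G.
Let c := \max_(v : G) gamma v.
Let key v := node_key n (gamma v) (id v).
Let mu := key_orientation key.
Let E := phase n.
Let A := protocol.

Lemma key_lt v u : gamma v < gamma u -> key v < key u.
Proof.
have := idP.2 v; rewrite -/n /key /node_key => /andP[_ le_v] lt_g.
by apply: (@leq_trans ((gamma v).+1 * (idmax n).+1)); [lia |];
  apply: leq_trans (leq_addr _ _); rewrite leq_mul2r lt_g orbT.
Qed.

Lemma key_inj : injective key.
Proof.
move=> u v eq_key; have [lt_g|lt_g|eq_g] := ltngtP (gamma u) (gamma v).
- by have := key_lt lt_g; rewrite eq_key ltnn.
- by have := key_lt lt_g; rewrite eq_key ltnn.
by apply: idP.1; apply: (@addnI (gamma u * (idmax n).+1)); rewrite {2}eq_g.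
Qed.

Lemma nnodes_gt0 : 0 < n. Proof. exact: graph_nonempty. Qed.

Lemma color_gt0 v : 0 < gamma v. Proof. exact: clustering.1. Qed.

Lemma color_le v : gamma v <= c. Proof. exact: leq_bigmax. Qed.

Lemma component_self v :
  component (color_class gamma (gamma v))
    [set w | connect (induced (color_class gamma (gamma v))) v w].
Proof. by exists v; rewrite ?inE. Qed.

Lemma delta_lt v : delta v < n.
Proof.
have [r [_ _ _ distr]] := clustering.2 _ _ (component_self v).
by apply: is_dist_lt_card (distr v _); rewrite inE connect0.
Qed.

(** Written over the same list of pairs as in [start], so that it is the value computed there from
    the [Hello] messages. *)
Definition cmax v : nat := \max_(q <- (gamma v, id v) ::
  [seq (gamma u, id u) | u <- port v]) q.1.

Lemma cmax_le v : cmax v <= c.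
Proof.
rewrite /cmax big_cons big_map geq_max color_le /=.
by elim/big_ind: _ => // [a b|u _]; [rewrite geq_max => -> | exact: color_le].
Qed.

Lemma color_le_cmax v : gamma v <= cmax v.
Proof. by rewrite /cmax big_cons leq_maxl. Qed.

Lemma adj_color_le_cmax v u : adj v u -> gamma u <= cmax v.
Proof.
rewrite -(portP v).2 => u_v.
rewrite /cmax big_cons big_map (big_rem u u_v) /=; lia.
Qed.

Definition schedule v : seq nat := wakeups n (gamma v) (delta v) (cmax v).

Lemma schedule_gt1 v t : t \in schedule v -> 1 < t.
Proof. by rewrite mem_wakeups => /andP[]. Qed.

Lemma schedule_le v t : t \in schedule v -> t <= 4 * (c * n).
Proof.
apply: wakeups_le; rewrite ?delta_lt ?color_le ?cmax_le //.
exact: leq_trans (color_gt0 v) (color_le v).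
Qed.

Lemma phase_gt1 m : 0 < m -> 1 < E m.
Proof. by move=> m_gt0; have := nnodes_gt0; rewrite /E /phase; nia. Qed.

Lemma schedule_local v t :
  t \in [:: E (gamma v) + n - delta v - 1; E (gamma v) + n - delta v;
            E (gamma v) + n + delta v; E (gamma v) + n + delta v + 1] ->
  t \in schedule v.
Proof.
move=> t_v; rewrite mem_wakeups t_v /= andbT.
have := phase_gt1 (color_gt0 v); have := delta_lt v.
by move: t_v; rewrite !inE => /or4P[] /eqP ->; lia.
Qed.

(** For the [k] of [dyadic_separation], [ceil2 k (gamma v)] and [floor2 k (gamma u)] coincide. Both
    nodes try this [k], because [gamma u] is at most [cmax] of either one. *)
Lemma schedule_meet v u : adj v u -> gamma v < gamma u ->
  exists m, [/\ gamma v < m, m <= gamma u, E m \in schedule v & E m \in schedule u].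
Proof.
move=> adj_vu lt_vu; have [k le_k eq_k] := dyadic_separation lt_vu.
have k2 : 0 < 2 ^ k by rewrite expn_gt0.
exists (floor2 k (gamma u)).
have lt_m : gamma v < floor2 k (gamma u) by rewrite /floor2 eq_k -ltn_divLR.
have k_iota w : gamma u <= cmax w -> k \in iota 0 (trunc_log 2 (cmax w)).+1.
  by move=> le_u; rewrite mem_iota ltnS; apply: leq_trans le_k (leq_trunc_log _ le_u).
have gt1 : 1 < phase n (floor2 k (gamma u)) by apply: phase_gt1; lia.
split=> //; first exact: leq_divM.
  rewrite mem_wakeups gt1 andTb; apply/orP; left; apply/orP; right.
  apply/mapP; exists k; first exact/k_iota/adj_color_le_cmax.
  by rewrite /E /ceil2 /floor2 eq_k.
rewrite mem_wakeups gt1 andTb; apply/orP; right.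
by apply/mapP; exists k; first exact/k_iota/color_le_cmax.
Qed.

(** * Execution invariant and spread of knowledge *)

Definition knows0 v : knowledge I := fun j =>
  if j == id v then Some (description id key port inp v) else None.

(* The knowledge of [v] after round [r.+1]. *)
Fixpoint known r v : knowledge I :=
  if r is r'.+1 then
    if r.+1 \in schedule v then
      foldr merge (known r' v)
        [seq known r' u | u <- port v & r.+1 \in schedule u]
    else known r' v
  else knows0 v.

(** The invariant tying the execution to the recursion [known]: what is left of the schedule decides
    between running and terminated. *)
Definition node_status r v : Prop :=
  let rest := [seq t <- schedule v | r.+1 < t] in
  if rest is t :: _ then
    exists2 cur, cur <= r.+1 &
      exec A id port x r.+1 v =
        Running O (Active (id v) (key v) (known r v) cur rest : state A) t
  else exec A id port x r.+1 v =
         Terminated _ (simulate F (known r v) (key v).+1 (id v)).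

Lemma node_statusP r v : node_status r v.
Proof.
elim: r v => [|r IHr] v.
  (* In round 1 all nodes are awake, so every [Hello] arrives. *)
  rewrite /node_status /= /round /=.
  set ms := [seq _ | u <- port v].
  have -> : pmap hello ms = [seq (gamma u, id u) | u <- port v].
    rewrite /ms; elim: (port v) => //= u s -> //.
  rewrite -/n -/(cmax v) -/(schedule v).
  have -> : [seq t <- schedule v | 1 < t] = schedule v.
    by apply/all_filterP/allP => t /schedule_gt1.
  have K0 : (fun j => if j == id v then Some (inp v,
      [seq q.2 | q <- [seq (gamma u, id u) | u <- port v]
               & node_key n q.1 q.2 < node_key n (gamma v) (id v)]) else None)
      = knows0 v.
    by apply: functional_extensionality => j; rewrite filter_map -map_comp.
  rewrite K0; have := @schedule_gt1 v.
  case: (schedule v) => [|t s] // /(_ t); rewrite inE eqxx => /(_ isT) t_gt1.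
  by exists 1 => //; congr Running; lia.
(* A node sends in round [r.+2] exactly when its schedule contains that round, as [known]
   presumes. *)
have delE u : delivered (A := A) port (exec A id port x r.+1) r.+2 u v =
    if r.+2 \in schedule u then Some (Know (known r u)) else None.
  have := IHr u; rewrite /node_status (filter_ltn_sorted r.+1 (wakeups_sorted _ _ _ _)).
  rewrite -/(schedule u) /delivered; case: ifP => r_u /=.
    by case=> cur _ ->; rewrite eqxx.
  case Es: [seq t <- _ | _] => [|t s]; first by move=> ->.
  case=> cur _ ->; case: eqP => // eq_t.
  have : t \in [seq t <- schedule u | r.+2 < t] by rewrite Es mem_head.
  by rewrite mem_filter eq_t ltnn.
have msE : pmap know [seq delivered (A := A) port (exec A id port x r.+1) r.+2 u v
                     | u <- port v]
    = [seq known r u | u <- port v & r.+2 \in schedule u].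
  elim: (port v) => //= u s ->; rewrite delE; by case: ifP.
have := IHr v; rewrite /node_status (filter_ltn_sorted r.+1 (wakeups_sorted _ _ _ _)).
rewrite -/(schedule v).
have execS : exec A id port x r.+2 = round port r.+2 (exec A id port x r.+1) by [].
rewrite execS /round [known r.+1 v]/=; case: ifP => r_v /=.
  case=> cur le_cur ->; rewrite eqxx /= msE.
  case Es: [seq t <- _ | _] => [|t s] //.
  exists r.+2 => //; congr Running.
  have : t \in [seq t <- schedule v | r.+2 < t] by rewrite Es mem_head.
  by rewrite mem_filter => /andP[]; lia.
case Es: [seq t <- _ | _] => [|t s]; first by move=> ->.
case=> cur le_cur ->.
have : t \in [seq t <- schedule v | r.+2 < t] by rewrite Es mem_head.
rewrite mem_filter => /andP[lt_t _].
case: eqP => [eq_t|_]; first by rewrite eq_t ltnn in lt_t.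
by exists cur => //; lia.
Qed.

Lemma isSome_foldr_merge K (k : G -> knowledge I) us j :
  isSome (foldr merge K [seq k u | u <- us] j) =
  isSome (K j) || has (fun u => isSome (k u j)) us.
Proof.
elim: us => [|u us IHus] /=; first by rewrite orbF.
by rewrite {1}/merge orbCA -IHus; case: (k u j).
Qed.

(** Only true descriptions circulate, so merging never meets a conflict and it is enough to track
    which nodes are described. *)
Lemma known_sound r v j f : known r v j = Some f ->
  exists u, j = id u /\ f = description id key port inp u.
Proof.
elim: r v f => [|r IHr] v f /=.
  by rewrite /knows0; case: eqP => // -> [<-]; exists v.
case: ifP => [_|_]; last exact: IHr.
elim: [seq u <- port v | _] => [|u us IHus] /=; first exact: IHr.
by rewrite {1}/merge; case Ku: (known r u j) => [f'|] // [<-]; apply: IHr Ku.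
Qed.

(** The predecessor makes [t] the number of the round just completed, as [known r] refers to round
    [r.+1]. *)
Definition knows t v u : bool := isSome (known t.-1 v (id u)).

Lemma knows_description t v u : knows t v u ->
  known t.-1 v (id u) = Some (description id key port inp u).
Proof.
rewrite /knows; case Ku: (known _ _ _) => [f|] // _.
by have [w [/(idP.1) -> ->]] := known_sound Ku.
Qed.

Lemma knows_self t v : knows t v v.
Proof.
rewrite /knows; elim: t.-1 => [|r IHr] /=; first by rewrite /knows0 eqxx.
by case: ifP => // _; rewrite isSome_foldr_merge IHr.
Qed.

Lemma knows_mono t t' v u : t <= t' -> knows t v u -> knows t' v u.
Proof.
rewrite /knows => le_t Ku.
have : t.-1 <= t'.-1 by lia.
elim: t'.-1 => [|r IHr]; first by rewrite leqn0 => /eqP <-.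
rewrite leq_eqVlt ltnS => /predU1P[<- //|/IHr Kr /=].
by case: ifP => // _; rewrite isSome_foldr_merge Kr.
Qed.

(** A message carries what its sender knew before the round, hence the shift from [t] to [t.+1]. *)
Lemma knows_transfer t v w u : adj v w -> t.+1 \in schedule v ->
  t.+1 \in schedule w -> knows t w u -> knows t.+1 v u.
Proof.
move=> adj_vw t_v t_w; have := schedule_gt1 t_v; case: t t_v t_w => // r t_v t_w _.
rewrite /knows /= t_v isSome_foldr_merge => Kw; apply/orP; right.
by apply/hasP; exists w; rewrite // mem_filter t_w (portP v).2.
Qed.

(** * Gathering and broadcasting inside a cluster *)

Section Cluster.
Variables (g : nat) (C : {set G}).
Hypothesis compC : component (color_class gamma g) C.

Lemma component_color v : v \in C -> gamma v = g.
Proof.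
case: compC => w; rewrite inE => /eqP gw ->; rewrite inE => /connectP[p].
case/lastP: p => [_ -> //|p y]; rewrite rcons_path last_rcons.
by case/andP=> _ /and3P[_ _]; rewrite inE => /eqP gy ->.
Qed.

Lemma component_adj v w : induced C w v -> adj v w /\ w \in C.
Proof. by move=> /and3P[adj_wv w_C _]; rewrite adj_sym. Qed.

Lemma cluster_relay v w u : v \in C -> w \in C -> knows (E g) w u ->
  knows (E g + n + delta v) v u.
Proof.
have [r [r_C r0 uniq_r dist_r]] := clustering.2 _ _ compC.
have local y t : y \in C ->
    t \in [:: E g + n - delta y - 1; E g + n - delta y;
              E g + n + delta y; E g + n + delta y + 1] -> t \in schedule y.
  by move=> y_C t_y; apply: schedule_local; rewrite (component_color y_C).
have parent y d : y \in C -> delta y = d.+1 ->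
    exists z, [/\ z \in C, adj y z & delta z = d].
  move=> y_C dy; have := dist_r y y_C; rewrite dy.
  case/is_dist_pred=> z [/component_adj[adj_yz z_C] dz].
  by exists z; split=> //; apply/dz/dist_r.
(* Gathering: a child at depth [d.+1] reports in round [E g + n - d.+1], the very round in which its
   parent at depth [d] listens. *)
have up d y : y \in C -> delta y = d -> knows (E g + n - d - 1) y u ->
    knows (E g + n) r u.
  elim: d y => [|d IHd] y y_C dy Ky.
    by rewrite -(uniq_r y y_C dy); apply: knows_mono Ky; lia.
  have [z [z_C adj_yz dz]] := parent y d y_C dy.
  have := delta_lt y; rewrite dy => lt_d.
  have tE : E g + n - d - 1 = (E g + n - d.+1 - 1).+1 by lia.
  apply: (IHd z z_C dz); rewrite tE; apply: knows_transfer Ky.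
  - by rewrite adj_sym.
  - by rewrite -tE; apply: local; rewrite // dz !inE eqxx.
  - apply: local; rewrite // dy !inE; apply/orP; right; apply/orP; left.
    by apply/eqP; lia.
(* Broadcasting: a parent at depth [d] speaks in round [E g + n + d + 1], when its children at depth
   [d.+1] listen. *)
have down d y : knows (E g + n) r u -> y \in C -> delta y = d ->
    knows (E g + n + d) y u.
  move=> Kr; elim: d y => [|d IHd] y y_C dy.
    by rewrite (uniq_r y y_C dy) addn0.
  have [z [z_C adj_yz dz]] := parent y d y_C dy.
  rewrite addnS; apply: knows_transfer adj_yz _ _ (IHd z z_C dz).
  - by apply: local; rewrite // dy !inE addnS eqxx !orbT.
  - by apply: local; rewrite // dz !inE addn1 eqxx !orbT.
(* As [delta w < n], what [w] knows at round [E g] is in time for its report. *)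
move=> v_C w_C Kw; apply: down => //; apply: (up _ _ w_C erefl).
by apply: knows_mono Kw; have := delta_lt w; lia.
Qed.

End Cluster.

(** * Spread of knowledge along directed paths *)

Lemma knows_reachable v u : connect mu v u ->
  knows (E (gamma v) + n + delta v) v u.
Proof.
(* Colors never increase along a directed path: it stays in the cluster of [v] for a while, then
   ends or drops to a smaller color, where the induction applies. *)
move eq_g: (gamma v) => g; elim/ltn_ind: g v u eq_g => g IHg v u gv mu_vu.
pose D := induced (color_class gamma g).
suff [w Dw Kw] : exists2 w, connect D v w & knows (E g) w u.
  have compv := component_self v; rewrite gv in compv.
  by apply: (cluster_relay compv _ _ Kw); rewrite inE.
case/connectP: mu_vu => p; elim: p v gv => [|y p IHp] v gv /=.
  by move=> _ ->; exists v; rewrite ?connect0 ?knows_self.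
case/andP=> /andP[adj_vy lt_key] mu_p eq_u.
have [lt_gy|gt_gy|gy] := ltngtP (gamma y) g.
- exists v; first exact: connect0.
  have Ky : knows (E (gamma y) + n + delta y) y u.
    by apply: (IHg _ lt_gy) => //; apply/connectP; exists p.
  have adj_yv : adj y v by rewrite adj_sym.
  have [|m [lt_m le_m m_y m_v]] := schedule_meet adj_yv; first by rewrite gv.
  have m_gt1 := schedule_gt1 m_v; have Em : E m = (E m).-1.+1 by lia.
  apply: (@knows_mono (E m)).
    by rewrite /E /phase leq_mul2l -gv le_m orbT.
  rewrite Em; apply: knows_transfer adj_vy _ _ _; rewrite -?Em //.
  (* A phase has [2 * n] rounds and [delta y < n], so [y] is informed before the next phase starts,
     hence before the meeting. *)
  apply: knows_mono Ky; have := delta_lt y.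
  have : E (gamma y).+1 <= E m by rewrite /E /phase leq_mul2l lt_m orbT.
  by rewrite /E /phase; lia.
- by have := key_lt (v := v) (u := y); rewrite gv => /(_ gt_gy); lia.
have [w Dw Kw] := IHp y gy mu_p eq_u; exists w => //.
by apply: connect_trans Dw; apply: connect1; rewrite /D /induced /= !inE adj_vy gv gy eqxx.
Qed.

(** * Termination, correctness and complexity *)

Lemma terminated r v : 4 * (c * n) <= r.+1 ->
  exec A id port x r.+1 v =
    Terminated _ (simulate F (known r v) (key v).+1 (id v)).
Proof.
move=> le_r; have := node_statusP r v; rewrite /node_status.
suff -> : [seq t <- schedule v | r.+1 < t] = [::] by [].
apply/eqP; rewrite -[_ == _]negbK -has_filter; apply/hasPn=> t /schedule_le.
by lia.
Qed.

Lemma horizon_gt0 : 0 < 4 * (c * n).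
Proof.
have /card_gt0P[v _] := graph_nonempty G.
have := color_gt0 v; have := color_le v; have := nnodes_gt0; nia.
Qed.

Lemma protocol_outputs out : admissible_order mu (key_order key) ->
  (forall v, greedy_run id inp mu F (key_order key) v = Some (out v)) ->
  forall v, exec A id port x (4 * (c * n)) v = Terminated _ (out v).
Proof.
move=> adm_s out_s v; have N_gt0 := horizon_gt0.
rewrite -(prednK N_gt0) terminated ?prednK //; congr Terminated.
apply: (simulateP (idP.1) portP adm_s out_s) => // u mu_vu.
apply: knows_description; apply: knows_mono (knows_reachable mu_vu).
(* The round by which [v] is informed belongs to its own schedule, so it is within the horizon. *)
apply: (@schedule_le v); apply: schedule_local.
by rewrite !inE eqxx !orbT.
Qed.

Lemma awake_at_schedule r v : awake_at A id port x r.+2 v -> r.+2 \in schedule v.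
Proof.
rewrite /awake_at /awake_in -pred_Sn.
have := node_statusP r v; rewrite /node_status.
case Es: [seq t <- _ | _] => [|t s]; first by move=> ->.
case=> cur _ -> /eqP <-.
have : t \in [seq t <- schedule v | r.+1 < t] by rewrite Es mem_head.
by rewrite mem_filter => /andP[].
Qed.

Lemma protocol_awake : awake_complexity_le A id port x (7 * (1 + trunc_log 2 c)).
Proof.
move=> v [|T]; first by rewrite big_geq.
(* Round 1 lies outside the schedule and is counted apart: [1 + 4 + 2 * (1 + trunc_log 2 c)] is
   within the bound. *)
rewrite big_ltn //.
have le1 : \sum_(2 <= r < T.+2) awake_at A id port x r v <= size (schedule v).
  apply: leq_trans (sum_mem_le (schedule v) 2 T.+2).
  rewrite big_nat_cond [leqRHS]big_nat_cond; apply: leq_sum => -[|[|r]] // _.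
  by case aw: awake_at => //; rewrite awake_at_schedule.
have := size_wakeups n (gamma v) (delta v) (cmax v); rewrite -/(schedule v).
have := leq_trunc_log 2 (cmax_le v).
by case: awake_at => /=; lia.
Qed.

End Run.
End Protocol.

Theorem theorem9 (idmax : nat -> nat) (idmax_poly : polynomially_bounded idmax)
    (I O : Type) (Pi : problem I O) (Pi_OLOCAL : O_LOCAL idmax Pi) :
  exists (A : algorithm (I * nat * nat) O) (a b : nat),
    forall (G : sgraph) (id : G -> nat) (port : G -> seq G)
           (inp : G -> I) (gamma delta : G -> nat),
      valid_ids idmax id -> valid_ports port ->
      colored_BFS_clustering gamma delta ->
      let x := fun v => (inp v, gamma v, delta v) in
      let n := nnodes G in
      let c := \max_(v : G) gamma v in
      exists out : G -> O,
        [/\ outputs A id port x out,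
            Pi G inp out,
            awake_complexity_le A id port x (a * (1 + trunc_log 2 c))
          & round_complexity_le A id port x (b * (c * n))].
Proof.
case: Pi_OLOCAL => F greedyF; exists (protocol idmax F), 7, 4.
move=> G id port inp gamma delta idP portP clustering x n c.
pose key v := node_key idmax n (gamma v) (id v).
have keyI : injective key by apply: key_inj idP.
have adm := key_order_admissible key.
(* The greedy algorithm is applied to the key orientation, with nodes picked by increasing key. *)
have [out out_s Pi_out] := greedyF G id inp _ _ idP (key_orientation_acyclic keyI) adm.
have outE := protocol_outputs idP portP clustering adm out_s.
exists out; split=> //.
- by move=> v; exists (4 * (c * n)); apply: outE.
- exact: protocol_awake.
- by move=> v; exists (4 * (c * n)) => //; exists (out v); apply: outE.
Qed.
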